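(* For any $a\in\mathbb{N}$, the following identities of differential operators hold: (1) $\mathcal{D}^{i+1\to i}_{0,a}\circ d=\gamma(i+1-\frac n2,a)\,\mathcal{D}^{i\to i}_{0,a+1}$ for $0\le i\le n-1$. (2) $\mathcal{D}^{i+1\to i+1}_{0,a}\circ d=0$ for $0\le i\le n-2$. (3) $\mathcal{D}^{i-1\to i-1}_{n-2i+2,a}\circ d^*=-\gamma(-i+1+\frac n2,a)\,\mathcal{D}^{i\to i-1}_{n-2i,a+1}$ for $1\le i\le n$. (4) $\mathcal{D}^{i-1\to i-2}_{n-2i+2,a}\circ d^*=0$ for $2\le i\le n$. Here $d$ and $d^*$ act on $\mathcal{E}^i(\mathbb{R}^n)$.
   Context: $n\ge2$; $\mathbb{N}=\{0,1,2,\dots\}$; $\mathcal{E}^i$: smooth complex-valued $i$-forms; $d$ the exterior derivative, $d^*$ its formal adjoint for the flat metric on $\mathbb{R}^n$. $\mathbb{R}^{n-1}=\{x_n=0\}\subset\mathbb{R}^n$, $\mathrm{Rest}_{x_n=0}$ is pull-back of forms, $\iota_{\partial/\partial x_n}$ interior multiplication, $\Delta_{\mathbb{R}^{n-1}}=\sum_{j=1}^{n-1}\partial^2/\partial x_j^2$. For $\mu\in\mathbb{C}$, $\ell\in\mathbb{N}$, $$\mathcal{D}^\mu_\ell=\sum_{k=0}^{[\ell/2]}\frac{2^{\ell-2k}}{k!(\ell-2k)!}\Big(\prod_{m=[(\ell+1)/2]}^{\ell-k-1}(\mu+m)\Big)\Delta_{\mathbb{R}^{n-1}}^k\Big(\frac{\partial}{\partial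 x_n}\Big)^{\ell-2k}$$ (empty product $=1$), acting coefficientwise, and $\mathcal{D}^\mu_\ell=0$ for $\ell<0$. $\gamma(\mu,a)=1$ for $a$ odd, $=\mu+\frac a2$ for $a$ even. For $u\in\mathbb{C}$, $a\in\mathbb{N}$ and $\mu:=u+i-\frac{n-1}2$, the operators $\mathcal{D}^{i\to i-1}_{u,a}:\mathcal{E}^i(\mathbb{R}^n)\to\mathcal{E}^{i-1}(\mathbb{R}^{n-1})$ ($1\le i\le n$) and $\mathcal{D}^{i\to i}_{u,a}:\mathcal{E}^i(\mathbb{R}^n)\to\mathcal{E}^{i}(\mathbb{R}^{n-1})$ ($0\le i\le n-1$) are $$\mathcal{D}^{i\to i-1}_{u,a}=\mathrm{Rest}_{x_n=0}\circ\Big(-\mathcal{D}^{\mu+1}_{a-2}dd^*\iota_{\frac{\partial}{\partial x_n}}-\gamma(\mu,a)\mathcal{D}^{\mu+1}_{a-1}d^*+\tfrac12(u+2i-n)\mathcal{D}^\mu_a\iota_{\frac{\partial}{\partial x_n}}\Big),$$ $$\mathcal{D}^{i\to i}_{u,a}=\mathrm{Rest}_{x_n=0}\circ\Big(\mathcal{D}^{\mu+1}_{a-2}dd^*-\gamma(\mu-\tfrac12,a)\mathcal{D}^{\mu}_{a-1}d\,\iota_{\frac{\partial}{\partial x_n}}+\tfrac12(u+a)\mathcal{D}^\mu_a\Big).$$ *)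

(* Defs.v *)
From HB Require Import structures.
From mathcomp Require Import all_boot all_order all_algebra.
From mathcomp Require Import complex ring.
From mathcomp Require Import all_classical all_reals all_analysis.

Set Implicit Arguments.
Unset Strict Implicit.
Unset Printing Implicit Defensive.

Import Order.TTheory GRing.Theory Num.Theory.
Import numFieldNormedType.Exports.

Local Open Scope complex_scope.
Local Open Scope ring_scope.

Section Functions.
Variables (R : realType) (n : nat).
Implicit Types (f : 'rV[R]_n -> R[i]) (j : 'I_n) (s : seq 'I_n).

(* 'R[i]' carries no normed R-module structure in the library, so calculus for
   complex-valued functions is done on real and imaginary parts. *)
Definition repart f : 'rV[R]_n -> R := fun x => complex.Re (f x).
Definition impart f : 'rV[R]_n -> R := fun x => complex.Im (f x).

Definition unit_vec j : 'rV[R]_n := delta_mx 0 j.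

Definition partial j f : 'rV[R]_n -> R[i] :=
  fun x => 'D_(unit_vec j) (repart f) x +i* 'D_(unit_vec j) (impart f) x.

Definition iter_partial s f := foldr partial f s.

Definition pderivable j (x : 'rV[R]_n) f :=
  derivable (repart f) x (unit_vec j) /\ derivable (impart f) x (unit_vec j).

Definition smooth f := forall s,
  [/\ continuous (repart (iter_partial s f)),
      continuous (impart (iter_partial s f)) &
      forall j x, pderivable j x (iter_partial s f)].

End Functions.

Section PartialRules.
Variables (R : realType) (n : nat) (j : 'I_n) (x : 'rV[R]_n).
Implicit Types (f g : 'rV[R]_n -> R[i]).

Lemma pderD f g : pderivable j x f -> pderivable j x g ->
  pderivable j x (fun y => f y + g y) /\
  partial j (fun y => f y + g y) x = partial j f x + partial j g x.
Proof.
move=> [f1 f2] [g1 g2].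
have e1 : repart (fun y => f y + g y) = repart f \+ repart g.
  by apply/funext => y; rewrite /repart raddfD.
have e2 : impart (fun y => f y + g y) = impart f \+ impart g.
  by apply/funext => y; rewrite /impart raddfD.
rewrite /pderivable /partial e1 e2; split; first by split; apply: derivableD.
by rewrite !deriveD.
Qed.

Lemma pder_sum (T : Type) (r : seq T) (F : T -> 'rV[R]_n -> R[i]) :
  (forall t, pderivable j x (F t)) ->
  pderivable j x (fun y => \sum_(t <- r) F t y) /\
  partial j (fun y => \sum_(t <- r) F t y) x = \sum_(t <- r) partial j (F t) x.
Proof.
move=> FD; elim: r => [|t r [IH1 IH2]].
  have -> : (fun y => \sum_(t <- [::]) F t y) = (fun=> 0).
    by apply/funext => y; rewrite big_nil.
  have e1 : repart (fun _ : 'rV[R]_n => 0) = cst 0 by [].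
  have e2 : impart (fun _ : 'rV[R]_n => 0) = cst 0 by [].
  rewrite big_nil /pderivable /partial e1 e2; split.
    by split; apply: derivable_cst.
  by rewrite !derive_cst.
have -> : (fun y => \sum_(t <- t :: r) F t y) =
          (fun y => F t y + \sum_(t <- r) F t y).
  by apply/funext => y; rewrite big_cons.
have [? e] := pderD (FD t) IH1.
by split => //; rewrite big_cons e IH2.
Qed.

Lemma pderMconj (c : R[i]) f g : pderivable j x f -> pderivable j x g ->
  pderivable j x (fun y => c * f y * Num.conj (g y)) /\
  partial j (fun y => c * f y * Num.conj (g y)) x =
    c * (partial j f x * Num.conj (g x) + f x * Num.conj (partial j g x)).
Proof.
case: c => c1 c2 [f1 f2] [g1 g2].
set h := fun y => _.
have e1 : repart h =
  (c1 \*: (repart f * repart g + impart f * impart g))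
  - (c2 \*: (impart f * repart g - repart f * impart g)).
  apply/funext => y; rewrite /repart /impart /h !fctE /=.
  by case: (f y) => ? ?; case: (g y) => ? ? /=; rewrite /GRing.scale /=; ring.
have e2 : impart h =
  (c2 \*: (repart f * repart g + impart f * impart g))
  + (c1 \*: (impart f * repart g - repart f * impart g)).
  apply/funext => y; rewrite /repart /impart /h !fctE /=.
  by case: (f y) => ? ?; case: (g y) => ? ? /=; rewrite /GRing.scale /=; ring.
have d1 := derivableM f1 g1; have d2 := derivableM f2 g2.
have d3 := derivableM f2 g1; have d4 := derivableM f1 g2.
have d5 := derivableD d1 d2; have d6 := derivableB d3 d4.
have z1 := derivableZ (k:=c1) d5; have z2 := derivableZ (k:=c2) d6.
have z3 := derivableZ (k:=c2) d5; have z4 := derivableZ (k:=c1) d6.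
have E5 := deriveD d1 d2; have E6 := deriveB d3 d4.
rewrite /pderivable /partial e1 e2; split.
  by split; [exact: (derivableB z1 z2)|exact: (derivableD z3 z4)].
rewrite (deriveB z1 z2) (deriveD z3 z4).
rewrite (deriveZ c1 d5) (deriveZ c2 d6) (deriveZ c2 d5) (deriveZ c1 d6) E5 E6.
rewrite (deriveM f1 g1) (deriveM f2 g2) (deriveM f2 g1) (deriveM f1 g2).
rewrite /GRing.scale /=.
rewrite {1}/repart {1}/impart.
case Ef : (f x) => [a b]; case Eg : (g x) => [a' b'].
rewrite /repart /impart Ef Eg /=.
by congr (_ +i* _); ring.
Qed.
End PartialRules.

(* A complex differential form  \sum_I w_I dx_I  on R^n is given by its
   coefficients w_I, where for I = {i_1 < ... < i_k} we write
   dx_I = dx_{i_1} /\ ... /\ dx_{i_k}.  Forms of all degrees live in the same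
   type, so that interior multiplication and d^* vanish on functions. *)
Notation dform R n := ({set 'I_n} -> 'rV[R]_n -> R[i]).

Section Forms.
Variables (R : realType) (n : nat).
Implicit Types (w : dform R n) (i : nat) (j : 'I_n) (I J : {set 'I_n}).

(* w \in E^i(R^n) *)
Definition is_form i w :=
  forall I, smooth (w I) /\ (#|I| != i -> forall x, w I x = 0).

Definition form_add w1 w2 : dform R n := fun I x => w1 I x + w2 I x.
Definition form_scale (c : R[i]) w : dform R n := fun I x => c * w I x.
Definition form_zero : dform R n := fun _ _ => 0.

Definition ext_sign j I : R[i] := (-1) ^+ #|[set k in I | (k < j)%N]|.

(* the coefficient of dx_I in dx_j /\ dx_J *)
Definition wedge_dx j I J : R[i] :=
  if (j \notin J) && (I == j |: J) then ext_sign j J else 0.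

(* interior multiplication by the j-th coordinate vector field:
   dx_j /\ dx_I  |->  dx_I  for j \notin I *)
Definition interior_mul j w : dform R n :=
  fun I x => if j \notin I then ext_sign j I * w (j |: I) x else 0.

(* First-order operator  \sum_j A_j d/dx_j  with constant matrix coefficients,
   A j I J being the (I, J) entry of A_j. *)
Definition diffop (A : 'I_n -> {set 'I_n} -> {set 'I_n} -> R[i]) w : dform R n :=
  fun I x => \sum_j \sum_J A j I J * partial j (w J) x.

(* Formal adjoint:  - \sum_j A_j^* d/dx_j, where A_j^* is the conjugate
   transpose, because the dx_I are orthonormal for the flat metric. *)
Definition adj_coef (A : 'I_n -> {set 'I_n} -> {set 'I_n} -> R[i]) j I J : R[i] :=
  - Num.conj (A j J I).

Definition ext_d : dform R n -> dform R n := diffop wedge_dx.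

Definition codiff : dform R n -> dform R n := diffop (adj_coef wedge_dx).

End Forms.

Arguments form_zero {R n}.

(* <A v, w> - <v, A^* w> is a divergence for the pointwise Hermitian product in
   which the dx_I are orthonormal; hence 'adj_coef' is the L^2 adjoint when one
   of the forms has compact support.  With A = wedge_dx this is the
   characteristic property of the codifferential. *)
Lemma green_identity (R : realType) n (A : 'I_n -> {set 'I_n} -> {set 'I_n} -> R[i])
    (v w : dform R n) (x : 'rV[R]_n) :
  (forall I, smooth (v I)) -> (forall I, smooth (w I)) ->
  \sum_I diffop A v I x * Num.conj (w I x)
  - \sum_I v I x * Num.conj (diffop (adj_coef A) w I x)
  = \sum_j partial j
      (fun y => \sum_I \sum_J A j I J * v J y * Num.conj (w I y)) x.
Proof.
move=> sv sw.
have dv J j : pderivable j x (v J) by have [_ _] := sv J [::]; apply.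
have dw J j : pderivable j x (w J) by have [_ _] := sw J [::]; apply.
under [RHS]eq_bigr => j _.
  rewrite (pder_sum _ (fun I => (pder_sum _ (fun J =>
            (pderMconj (A j I J) (dv J j) (dw I j)).1)).1)).2.
  under eq_bigr => I _.
    rewrite (pder_sum _ (fun J => (pderMconj (A j I J) (dv J j) (dw I j)).1)).2.
    under eq_bigr => J _ do
      rewrite (pderMconj (A j I J) (dv J j) (dw I j)).2 mulrDr.
    rewrite big_split /=.
    over.
  rewrite big_split /=.
  over.
rewrite big_split /=; congr (_ + _).
  rewrite exchange_big; apply: eq_bigr => I _.
  rewrite /diffop mulr_suml; apply: eq_bigr => j _.
  rewrite mulr_suml; apply: eq_bigr => J _; ring.
under [RHS]eq_bigr => j _ do rewrite exchange_big.
rewrite exchange_big -sumrN; apply: eq_bigr => I _.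
rewrite /diffop rmorph_sum mulr_sumr -sumrN; apply: eq_bigr => j _.
rewrite rmorph_sum mulr_sumr -sumrN; apply: eq_bigr => J _.
rewrite /adj_coef rmorphM rmorphN /= conjCK; ring.
Qed.

(* From here on the ambient space is R^n with n = m.+1, and the hyperplane
   x_n = 0 is R^m; the index of x_n is 'ord_max'. *)
Section SymmetryBreaking.
Variables (R : realType) (m : nat).
Implicit Types (f : 'rV[R]_m.+1 -> R[i]) (w : dform R m.+1).

Definition incl (y : 'rV[R]_m) : 'rV[R]_m.+1 :=
  \row_j (if unlift ord_max j is Some k then y 0 k else 0).

(* pull-back along 'incl': dx_n |-> 0, and dx_k |-> dx_k for k < n *)
Definition rest_hyp w : dform R m :=
  fun I y => w (lift ord_max @: I) (incl y).

Definition laplacian_hyp f : 'rV[R]_m.+1 -> R[i] :=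
  fun x => \sum_(k < m) partial (lift ord_max k) (partial (lift ord_max k) f) x.

Definition scalar_D (mu : R[i]) (l : int) f : 'rV[R]_m.+1 -> R[i] :=
  match l with
  | Posz l => fun x =>
      \sum_(k < l./2.+1)
        (2%:R ^+ (l - k.*2) / (k`! * (l - k.*2)`!)%:R
         * \prod_(uphalf l <= p < l - k) (mu + p%:R)
         * iter k laplacian_hyp (iter (l - k.*2) (partial ord_max) f) x)
  | Negz _ => fun=> 0
  end.

Definition form_D mu l w : dform R m.+1 := fun I => scalar_D mu l (w I).

Definition gamma_coef (mu : R[i]) (a : nat) : R[i] :=
  if odd a then 1 else mu + a%:R / 2%:R.

(* u + i - (n - 1) / 2 *)
Definition mu_param (u : R[i]) (i : nat) : R[i] := u + i%:R - m%:R / 2%:R.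

Local Notation iota_n := (interior_mul ord_max).
Local Infix "+f" := form_add (at level 50, left associativity).
Local Infix "*f" := form_scale (at level 40).

(* D_{u,a}^{i -> i-1} *)
Definition D_down (i : nat) (u : R[i]) (a : nat) w : dform R m :=
  let mu := mu_param u i in
  rest_hyp
    ((-1) *f form_D (mu + 1) (a%:Z - 2) (ext_d (codiff (iota_n w)))
     +f (- gamma_coef mu a) *f form_D (mu + 1) (a%:Z - 1) (codiff w)
     +f ((u + (2 * i)%:R - m.+1%:R) / 2%:R) *f form_D mu a (iota_n w)).

(* D_{u,a}^{i -> i} *)
Definition D_same (i : nat) (u : R[i]) (a : nat) w : dform R m :=
  let mu := mu_param u i in
  rest_hyp
    (form_D (mu + 1) (a%:Z - 2) (ext_d (codiff w))
     +f (- gamma_coef (mu - 1 / 2%:R) a)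
        *f form_D mu (a%:Z - 1) (ext_d (iota_n w))
     +f ((u + a%:R) / 2%:R) *f form_D mu a w).

End SymmetryBreaking.

(* Main.v *)
From HB Require Import structures.
Require Import Defs.
From mathcomp Require Import all_boot all_order all_algebra.
From mathcomp Require Import complex ring lra zify.
From mathcomp Require Import all_classical all_reals all_analysis.

Set Implicit Arguments.
Unset Strict Implicit.
Unset Printing Implicit Defensive.

Import Order.TTheory GRing.Theory Num.Theory.
Import numFieldNormedType.Exports.
Local Open Scope complex_scope.
Local Open Scope ring_scope.

(** The four identities hold already between operators on R^n, before pulling back
    to the hyperplane, and they are consequences of algebra alone.

    Write L for the Laplacian of the hyperplane, N for the normal derivative and
    iota for interior multiplication by its vector field. All operators have
    constant coefficients, and partial derivatives of smooth functions commute
    (Schwarz's theorem, [derive_comm]). Together with the anticommutation relations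
    between exterior and interior multiplication ([ladder_clifford]) this gives
    d^2 = 0 and (d^* )^2 = 0, the formula d d^* + d^* d = - (L + N^2) ([hodge]),
    Cartan's formula d iota + iota d = N ([cartan]), and
    d^* iota + iota d^* = 0 ([iota_codiff_op]).

    These relations settle the two identities for precomposition with d^*
    ([same_op_codiff], [down_op_codiff]). For precomposition with d they reduce the
    claim to identities between the scalar operators D^mu_a, seen as polynomials in
    the commuting operators L and N. All of those follow from two contiguity
    relations,
      gamma(mu, a) D^{mu+1}_{a-1} - gamma(mu - 1/2, a) D^mu_{a-1} = D^{mu+1}_{a-2} N
      D^{mu+1}_{a-2} (L + N^2) + gamma(mu - 1/2, a) D^mu_{a-1} N = (a / 2) D^mu_a
    ([juhl_op_contiguity], [juhl_op_lap]), which are checked on coefficients. The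
    second one is the vanishing statement for d ([same_op_d]). For the other
    identity ([down_op_d]) one expands d d^* iota d as (L + N^2) d iota + N d d^* and
    compares the coefficients of d d^*, of d iota and of the identity. *)

(** * Calculus of smooth functions *)

Section MixedPartials.
Variables (R : realType) (V : normedModType R).
Implicit Types (f : V -> R) (x y u v : V) (s t h : R).

Lemma is_derive_line f y u t : derivable f (t *: u + y) u ->
  is_derive t 1 (fun s => f (s *: u + y)) ('D_u f (t *: u + y)).
Proof.
move=> df.
have E : (fun h => h^-1 *: (f ((h *: 1 + t) *: u + y) - f (t *: u + y))) =
         (fun h => h^-1 *: (f (h *: u + (t *: u + y)) - f (t *: u + y))).
  by apply/funext => h; rewrite [h *: 1]mulr1 scalerDl addrA.
by apply: DeriveDef; rewrite /derivable /derive /= E.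
Qed.

Lemma MVT_line f y u h : 0 < h -> (forall x, derivable f x u) ->
  exists2 t, 0 < t < h & f (h *: u + y) - f y = h * 'D_u f (t *: u + y).
Proof.
move=> h0 df.
have D t : is_derive t 1 (fun s => f (s *: u + y)) ('D_u f (t *: u + y)).
  exact: is_derive_line.
have [|t tI E] := MVT h0 (fun t _ => D t).
  by apply: derivable_within_continuous => t _; apply: (@ex_derive _ _ _ _ _ _ _ (D t)).
exists t; first by rewrite in_itv in tI.
by rewrite scale0r add0r subr0 in E; rewrite E mulrC.
Qed.

(** Two applications of the mean value theorem, to the increment in the direction
    v and then to its derivative along u, turn the second difference of f over
    a parallelogram into a mixed derivative at an interior point. The second
    difference is symmetric in u and v, which is what makes it useful for
    comparing the two mixed derivatives. *)
Lemma second_difference f x u v h : 0 < h ->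
  (forall x, derivable f x u) -> (forall x, derivable ('D_u f) x v) ->
  exists s t, [/\ 0 < s < h, 0 < t < h &
    f (h *: u + h *: v + x) - f (h *: u + x) - f (h *: v + x) + f x =
    h * (h * 'D_v ('D_u f) (s *: u + t *: v + x))].
Proof.
move=> h0 df ddf.
pose g y := f (h *: v + y) - f y.
have shift y : derivable (fun y => f (h *: v + y)) y u /\
    'D_u (fun y => f (h *: v + y)) y = 'D_u f (h *: v + y).
  have E : (fun k => k^-1 *: (f (h *: v + (k *: u + y)) - f (h *: v + y))) =
           (fun k => k^-1 *: (f (k *: u + (h *: v + y)) - f (h *: v + y))).
    by apply/funext => k; rewrite addrCA.
  split; last by rewrite /derive /= E.
  by rewrite /derivable /= E; exact: df.
have dg y : derivable g y u by apply: derivableB; [exact: (shift y).1|].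
have [s sI Es] := MVT_line x h0 dg.
have [t tI Et] := MVT_line (s *: u + x) h0 ddf.
exists s, t; split=> //.
have e : 'D_u g (s *: u + x) =
    'D_u f (h *: v + (s *: u + x)) - 'D_u f (s *: u + x).
  by rewrite (deriveB (shift _).1 (df _)) (shift _).2.
rewrite e Et in Es.
have -> : s *: u + t *: v + x = t *: v + (s *: u + x) by rewrite addrCA addrA.
by rewrite -Es /g -[h *: u + h *: v + x]addrA [h *: u + (_ + _)]addrCA; ring.
Qed.

Lemma continuous_parallelogram f x u v (e : R) : {for x, continuous f} ->
  0 < e -> exists2 d, 0 < d & forall s t, 0 < s < d -> 0 < t < d ->
    `|f x - f (s *: u + t *: v + x)| < e.
Proof.
move=> /cvgrPdist_lt/(_ e) + e0 => /(_ e0) /nbhs_ballP [r /= r0 B].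
have c0 : 0 < `|u| + `|v| + 1 by rewrite ltr_wpDl// addr_ge0.
exists (r / (`|u| + `|v| + 1)); first exact: divr_gt0.
move=> s t /andP[s0 sd] /andP[t0 td]; apply: B; rewrite -ball_normE /=.
rewrite opprD addrCA subrr addr0 normrN.
apply: (le_lt_trans (ler_normD _ _)); rewrite !normrZ !gtr0_norm//.
have S : s * (`|u| + `|v| + 1) < r by rewrite -ltr_pdivlMr.
have T : t * (`|u| + `|v| + 1) < r by rewrite -ltr_pdivlMr.
have [st|/ltW ts] := leP s t.
  by have := ler_wpM2r (normr_ge0 u) st; lra.
by have := ler_wpM2r (normr_ge0 v) ts; lra.
Qed.

(** Schwarz's theorem. For small h the second difference over the parallelogram
    with sides h u and h v equals h^2 times either mixed derivative, each at some
    point close to x; continuity at x then leaves no gap between the two. *)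
Lemma derive_comm f x u v :
  (forall x, derivable f x u) -> (forall x, derivable f x v) ->
  (forall x, derivable ('D_u f) x v) -> (forall x, derivable ('D_v f) x u) ->
  {for x, continuous ('D_v ('D_u f))} -> {for x, continuous ('D_u ('D_v f))} ->
  'D_v ('D_u f) x = 'D_u ('D_v f) x.
Proof.
move=> du dv duv dvu cuv cvu; apply/eqP; rewrite -subr_eq0 -normr_le0.
apply/ler_addgt0Pl => e e0; rewrite addr0.
have e2 : 0 < e / 2 by rewrite divr_gt0.
have [d1 d10 B1] := continuous_parallelogram u v cuv e2.
have [d2 d20 B2] := continuous_parallelogram v u cvu e2.
pose h := Num.min d1 d2.
have h0 : 0 < h by rewrite lt_min d10.
have h1 : h <= d1 by rewrite ge_min lexx.
have h2 : h <= d2 by rewrite ge_min lexx orbT.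
have [s [t [/andP[s0 sh] /andP[t0 th] E]]] := second_difference x h0 du duv.
have [s' [t' [/andP[s0' sh'] /andP[t0' th'] E']]] :=
  second_difference x h0 dv dvu.
have {E E'} : 'D_v ('D_u f) (s *: u + t *: v + x) =
              'D_u ('D_v f) (s' *: v + t' *: u + x).
  apply: (mulfI (lt0r_neq0 h0)); apply: (mulfI (lt0r_neq0 h0)).
  apply: etrans (esym E) (etrans _ E'); congr (_ + _).
  by rewrite [h *: v + h *: u]addrC; exact: addrAC.
have I d r : 0 < r -> r < h -> h <= d -> 0 < r < d.
  by move=> r0 rh hd; rewrite r0 (lt_le_trans rh hd).
have b1 := B1 s t (I _ _ s0 sh h1) (I _ _ t0 th h1).
have b2 := B2 s' t' (I _ _ s0' sh' h2) (I _ _ t0' th' h2).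
move=> E; rewrite -E in b2.
move: ('D_v ('D_u f) (_ + x)) b1 b2 => C b1 b2.
move: ('D_v ('D_u f) x) ('D_u ('D_v f) x) b1 b2 => A B b1 b2.
have -> : A - B = (A - C) - (B - C) by ring.
apply: (le_trans (ler_normB _ _)); rewrite (splitr e).
exact: lerD (ltW b1) (ltW b2).
Qed.
End MixedPartials.

Section SmoothFunctions.
Variables (R : realType) (n : nat).
Implicit Types (f g : 'rV[R]_n -> R[i]) (j k : 'I_n) (c : R[i]).

Lemma smooth_pderivable f j x : smooth f -> pderivable j x f.
Proof. by move=> /(_ [::])[_ _]; apply. Qed.

Lemma smooth_partial f j : smooth f -> smooth (partial j f).
Proof. by move=> sf s; have := sf (rcons s j); rewrite /iter_partial foldr_rcons. Qed.

(** Deduced from the Leibniz rule with the constant function 1. *)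
Lemma pderZ j x c f : pderivable j x f ->
  pderivable j x (fun y => c * f y) /\
  partial j (fun y => c * f y) x = c * partial j f x.
Proof.
move=> df.
have d1 : pderivable j x (cst 1).
  by split; apply: derivable_cst.
have [] := pderMconj c df d1.
under eq_fun do rewrite rmorph1 mulr1.
move=> ? ->; split=> //.
have -> : partial j (cst 1) x = 0.
  by rewrite /partial -[repart _]/(cst 1) -[impart _]/(cst 0) !derive_cst.
by rewrite rmorph0 mulr0 addr0 rmorph1 mulr1.
Qed.

Lemma partial_lin c f g j : smooth f -> smooth g ->
  partial j (fun y => c * f y + g y) = fun y => c * partial j f y + partial j g y.
Proof.
move=> sf sg; apply/funext => x.
have [df Ef] := pderZ c (smooth_pderivable j x sf).
by rewrite (pderD df (smooth_pderivable j x sg)).2 Ef.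
Qed.

Lemma smooth_lin c f g : smooth f -> smooth g -> smooth (fun y => c * f y + g y).
Proof.
move=> sf sg s.
have -> : iter_partial s (fun y => c * f y + g y) =
  fun y => c * iter_partial s f y + iter_partial s g y.
  elim: s => //= j s ->; apply: partial_lin.
  - elim: s => [|? s IH] /=; [exact: sf|exact: smooth_partial].
  - elim: s => [|? s IH] /=; [exact: sg|exact: smooth_partial].
have [cf1 cf2 df] := sf s; have [cg1 cg2 dg] := sg s.
case: c => a b.
set F := iter_partial s f; set G := iter_partial s g.
have e1 : repart (fun y => (a +i* b) * F y + G y) =
    cst a * repart F - cst b * impart F + repart G.
  by apply/funext => y; rewrite /repart /impart !fctE; case: (F y); case: (G y).
have e2 : impart (fun y => (a +i* b) * F y + G y) =
    cst a * impart F + cst b * repart F + impart G.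
  by apply/funext => y; rewrite /repart /impart !fctE; case: (F y); case: (G y).
split.
- rewrite e1 => x; apply: continuousD; last exact: cg1.
  by apply: continuousB; apply: continuousM;
    first [exact: cst_continuous|exact: cf1|exact: cf2].
- rewrite e2 => x; apply: continuousD; last exact: cg2.
  by apply: continuousD; apply: continuousM;
    first [exact: cst_continuous|exact: cf1|exact: cf2].
- by move=> j x; exact: (pderD (pderZ _ (df j x)).1 (dg j x)).1.
Qed.

Lemma smooth0 : smooth (fun _ : 'rV[R]_n => 0 : R[i]).
Proof.
move=> s.
have -> : iter_partial s (fun _ : 'rV[R]_n => 0 : R[i]) = fun=> 0.
  elim: s => //= j s ->; apply/funext => x.
  by rewrite /partial -[repart _]/(cst 0) -[impart _]/(cst 0) !derive_cst.
by split=> [|| j x]; [exact: (@cst_continuous _ _ (0 : R))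
  | exact: (@cst_continuous _ _ (0 : R)) | split; exact: derivable_cst].
Qed.

Lemma partial_comm f j k : smooth f ->
  partial j (partial k f) = partial k (partial j f).
Proof.
move=> sf; apply/funext => x; rewrite /partial.
have [_ _ d] := sf [::]; have [_ _ dj] := sf [:: j]; have [_ _ dk] := sf [:: k].
have [cjr cji _] := sf [:: j; k]; have [ckr cki _] := sf [:: k; j].
have re : 'D_(unit_vec R j) (repart (partial k f)) x =
          'D_(unit_vec R k) (repart (partial j f)) x.
  exact: (@derive_comm _ _ (repart f) x (unit_vec R k) (unit_vec R j)
    (fun y => (d k y).1) (fun y => (d j y).1) (fun y => (dk j y).1)
    (fun y => (dj k y).1) (cjr x) (ckr x)).
have im : 'D_(unit_vec R j) (impart (partial k f)) x =
          'D_(unit_vec R k) (impart (partial j f)) x.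
  exact: (@derive_comm _ _ (impart f) x (unit_vec R k) (unit_vec R j)
    (fun y => (d k y).2) (fun y => (d j y).2) (fun y => (dk j y).2)
    (fun y => (dj k y).2) (cji x) (cki x)).
exact: (f_equal2 (@Complex R) re im).
Qed.
End SmoothFunctions.

(** * Contiguity relations for the coefficients *)

Section JuhlCoefficients.
Variable R : realType.
Implicit Types (mu x : R[i]) (k j s a : nat).

Definition rising x s : R[i] := \prod_(p < s) (x + p%:R).

Lemma risingSl x s : rising x s.+1 = x * rising (x + 1) s.
Proof.
rewrite /rising big_ord_recl addr0; congr (_ * _); apply: eq_bigr => p _.
by rewrite -addrA -natr1 [p%:R + 1]addrC.
Qed.

Lemma risingSr x s : rising x s.+1 = rising x s * (x + s%:R).
Proof. exact: big_ord_recr. Qed.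

(** The coefficient of L^k N^j in the operator of degree j + 2k, where L is the
    Laplacian of the hyperplane and N the normal derivative. Indexing by (k, j)
    instead of (k, degree) makes multiplication by L or N a shift of one index. *)
Definition juhl mu k j : R[i] :=
  2%:R ^+ j / (k`! * j`!)%:R
  * \prod_(uphalf (j + k.*2) <= p < j + k) (mu + p%:R).

Lemma prod_nat_rising mu q s :
  \prod_(q <= p < q + s) (mu + p%:R) = rising (mu + q%:R) s.
Proof.
rewrite -{1}[q]add0n big_addn addKn big_mkord; apply: eq_bigr => p _.
by rewrite natrD [p%:R + _]addrC addrA.
Qed.

(** Splitting by the parity of j removes the rounding in the bounds of the product,
    which becomes a rising factorial; the contiguity relations then follow from
    the two ways of peeling a factor off a rising factorial. *)
Lemma juhl_even mu k s : juhl mu k s.*2 =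
  4%:R ^+ s / (k`!%:R * (s.*2)`!%:R) * rising (mu + k%:R + s%:R) s.
Proof.
rewrite /juhl -doubleD uphalf_double.
have -> : (s.*2 + k = s + k + s)%N by rewrite -addnn addnAC.
by rewrite prod_nat_rising natrD [X in mu + X]addrC addrA natrM -mul2n exprM -natrX.
Qed.

Lemma juhl_odd mu k s : juhl mu k s.*2.+1 =
  2%:R * 4%:R ^+ s / (k`!%:R * (s.*2.+1)`!%:R)
  * rising (mu + k%:R + s%:R + 1) s.
Proof.
rewrite /juhl addSn -doubleD uphalfE /= doubleK.
have -> : (s.*2.+1 + k = (s + k).+1 + s)%N by rewrite -addnn; lia.
have e : (s + k).+1%:R = k%:R + s%:R + 1 :> R[i] by rewrite -natrD natr1 addnC.
by rewrite prod_nat_rising e 2!addrA natrM -mul2n exprS exprM -natrX.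
Qed.

Lemma nat_factS s : s.+1`!%:R = s.+1%:R * s`!%:R :> R[i].
Proof. by rewrite factS natrM. Qed.

Lemma fact_neq0 s : s`!%:R != 0 :> R[i].
Proof. by rewrite pnatr_eq0 -lt0n fact_gt0. Qed.

(** In the product k and mu occur only through mu + k. *)
Lemma juhlSk mu k j : k.+1%:R * juhl mu k.+1 j = juhl (mu + 1) k j.
Proof.
rewrite /juhl.
have -> : uphalf (j + k.+1.*2) = (uphalf (j + k.*2) + 1)%N.
  by rewrite addn1 doubleS !addnS uphalfE.
have -> : (j + k.+1 = j + k + 1)%N by rewrite addn1 addnS.
rewrite big_addn addnK.
have -> : \prod_(uphalf (j + k.*2) <= p < j + k) (mu + (p + 1)%:R) =
  \prod_(uphalf (j + k.*2) <= p < j + k) (mu + 1 + p%:R).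
  by apply: eq_bigr => p _; rewrite natrD addrAC addrA.
rewrite mulrA; congr (_ * _); rewrite !natrM.
have h1 := fact_neq0 k; have h2 := fact_neq0 j.
by field; rewrite h1 h2 nat1r pnatr_eq0.
Qed.

(** Coefficients of the operator multiplied by N, respectively by L. *)
Definition shiftN (c : nat -> nat -> R[i]) k j :=
  if j is j'.+1 then c k j' else 0.
Definition shiftL (c : nat -> nat -> R[i]) k j :=
  if k is k'.+1 then c k' j else 0.

Lemma shiftL_juhl mu k j : shiftL (juhl (mu + 1)) k j = k%:R * juhl mu k j.
Proof. by case: k => [|k] /=; rewrite ?mul0r ?juhlSk. Qed.

Lemma nat_double s : s.*2%:R = 2%:R * s%:R :> R[i].
Proof. by rewrite -mul2n natrM. Qed.

Lemma even_or_odd j : exists s, j = s.*2 \/ j = s.*2.+1.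
Proof.
by exists j./2; case: (odd j) (odd_double_half j) => E; [right|left]; rewrite -[LHS]E.
Qed.

(** Coefficient form of the relation
      gamma(mu, a) D^{mu+1}_{a-1} - gamma(mu - 1/2, a) D^mu_{a-1}
        = D^{mu+1}_{a-2} N,  with a - 1 = j + 2k. *)
Lemma juhl_contiguity_N mu k j :
  gamma_coef mu (j + k.*2).+1 * juhl (mu + 1) k j
  - gamma_coef (mu - 1 / 2%:R) (j + k.*2).+1 * juhl mu k j
  = shiftN (juhl (mu + 1)) k j.
Proof.
rewrite /gamma_coef oddS oddD odd_double addbF.
have h1 := fact_neq0 k.
have [s [->|->]] := even_or_odd j.
  rewrite odd_double !mul1r !juhl_even.
  case: s => [|s]; first by rewrite /rising !big_ord0 /= subrr.
  rewrite doubleS /= juhl_odd [rising (mu + 1 + _ + _) _]risingSr.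
  rewrite [rising (mu + _ + _) _]risingSl !nat_factS.
  have -> : mu + 1 + k%:R + s.+1%:R = mu + k%:R + s%:R + 2%:R by rewrite -natr1; ring.
  have -> : mu + k%:R + s.+1%:R + 1 = mu + k%:R + s%:R + 2%:R by rewrite -natr1; ring.
  have -> : mu + 1 + k%:R + s%:R + 1 = mu + k%:R + s%:R + 2%:R by ring.
  move: (rising _ s) (s.*2`!%:R) (fact_neq0 s.*2) => X F h2.
  rewrite exprS -!natr1 nat_double.
  by field; rewrite h1 h2 -nat_double !natr1 !pnatr_eq0.
rewrite /= odd_double /= !juhl_odd juhl_even nat_factS.
have -> : (s.*2.+1 + k.*2).+1%:R = 2%:R * (k%:R + s%:R + 1) :> R[i].
  by rewrite addSn -doubleD -doubleS nat_double -natrD natr1 addnC.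
rewrite -[s.*2.+1%:R]natr1 nat_double.
set x := mu + k%:R + s%:R.
have -> : mu + 2%:R * (k%:R + s%:R + 1) / 2%:R = x + 1.
  by rewrite /x; field.
have -> : mu + 1 + k%:R + s%:R + 1 = x + 1 + 1 by rewrite /x; ring.
have -> : mu + 1 + k%:R + s%:R = x + 1 by rewrite /x; ring.
(* gamma(mu, a) is the missing first factor of the rising factorial. *)
rewrite [(x + 1) * _]mulrCA -risingSl risingSr /x.
move: (rising _ s) (s.*2`!%:R) (fact_neq0 s.*2) => X F h2.
by field; rewrite h1 h2 -nat_double natr1 pnatr_eq0.
Qed.

(** Coefficient form of the relation
      D^{mu+1}_{a-2} (L + N^2) + gamma(mu - 1/2, a) D^mu_{a-1} N
        = (a / 2) D^mu_a,  with a = j + 2k. *)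
Lemma juhl_contiguity_L mu k j :
  shiftL (juhl (mu + 1)) k j + shiftN (shiftN (juhl (mu + 1))) k j
  + gamma_coef (mu - 1 / 2%:R) (j + k.*2) * shiftN (juhl mu) k j
  = (j + k.*2)%:R / 2%:R * juhl mu k j.
Proof.
(* The term from L contributes k, so that what is left to show has j / 2 in
   place of (j + 2k) / 2 on the right. *)
rewrite shiftL_juhl /gamma_coef oddD odd_double addbF natrD nat_double.
have h1 := fact_neq0 k.
have [s [->|->]] := even_or_odd j.
  rewrite odd_double nat_double; case: s => [|s] /=; first by field.
  rewrite -[juhl mu k _]/(juhl mu k s.+1.*2) juhl_odd !juhl_even.
  rewrite doubleS !nat_factS [rising (mu + k%:R + s.+1%:R) _]risingSr.
  have -> : mu + 1 + k%:R + s%:R = mu + k%:R + s%:R + 1 by ring.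
  have -> : mu + k%:R + s.+1%:R = mu + k%:R + s%:R + 1 by rewrite -natr1 addrA.
  move: (rising _ s) (s.*2`!%:R) (fact_neq0 s.*2) => X F h2.
  rewrite exprS -!natr1 nat_double.
  by field; rewrite h1 h2 -nat_double !natr1 !pnatr_eq0.
rewrite /= odd_double /= -natr1 nat_double.
case: s => [|s].
  rewrite -[shiftN _ _ _]/0 -[juhl mu k 0.*2.+1]/(juhl mu k 0.*2.+1).
  rewrite juhl_even juhl_odd /rising !big_ord0 -[0.*2]/0%N.
  by rewrite factS fact0; field.
rewrite -[shiftN _ _ _]/(juhl (mu + 1) k s.*2.+1) juhl_odd juhl_even.
rewrite juhl_odd doubleS !nat_factS.
rewrite [rising (mu + k%:R + s.+1%:R) _]risingSl.
rewrite [rising (mu + k%:R + s.+1%:R + 1) _]risingSr.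
have -> : mu + 1 + k%:R + s%:R + 1 = mu + k%:R + s%:R + 2%:R by ring.
have -> : mu + k%:R + s.+1%:R + 1 = mu + k%:R + s%:R + 2%:R by rewrite -natr1; ring.
move: (rising _ s) (s.*2`!%:R) (fact_neq0 s.*2) => X F h2.
rewrite exprS -!natr1 nat_double.
by field; rewrite h1 h2 -nat_double !natr1 !pnatr_eq0.
Qed.
End JuhlCoefficients.

(** * Homogeneous operators in the tangential Laplacian and the normal derivative *)

Section HomogeneousOperators.
Variables (R : realType) (W : lmodType R[i]) (L N : {linear W -> W}).
Hypothesis LN : forall w, L (N w) = N (L w).
Implicit Types (c : nat -> nat -> R[i]) (mu : R[i]) (w : W) (l a : nat).

Definition homog c l w : W :=
  \sum_(k < l./2.+1) c k (l - k.*2)%N *: iter k L (iter (l - k.*2) N w).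

Lemma iter_linear (f : {linear W -> W}) n : linear (iter n f).
Proof. by move=> x u v; elim: n => //= n ->; rewrite linearP. Qed.

Lemma homog_is_linear c l : linear (homog c l).
Proof.
move=> x u v; rewrite /homog scaler_sumr -big_split; apply: eq_bigr => k _ /=.
by rewrite !iter_linear scalerDr scalerA mulrC -scalerA.
Qed.

HB.instance Definition _ c l :=
  GRing.isLinear.Build R[i] W W *:%R (homog c l) (homog_is_linear c l).

Lemma eq_homog c c' l : (forall k j, (j + k.*2)%N = l -> c k j = c' k j) ->
  homog c l =1 homog c' l.
Proof.
move=> E w; apply: eq_bigr => k _; rewrite E// subnK//.
by rewrite -geq_half_double -ltnS.
Qed.

Lemma homogD c c' l w :
  homog (fun k j => c k j + c' k j) l w = homog c l w + homog c' l w.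
Proof. by rewrite -big_split; apply: eq_bigr => k _; rewrite scalerDl. Qed.

Lemma homogZ x c l w : homog (fun k j => x * c k j) l w = x *: homog c l w.
Proof. by rewrite scaler_sumr; apply: eq_bigr => k _; rewrite scalerA. Qed.

(** The right-hand sum has one more term when l is odd, namely the one without N,
    whose shifted coefficient vanishes. *)
Lemma homog_shiftN c l w : homog c l (N w) = homog (shiftN c) l.+1 w.
Proof.
rewrite /homog (big_ord_widen (l.+1./2.+1)
  (fun k => c k (l - k.*2)%N *: iter k L (iter (l - k.*2) N (N w))));
  last by rewrite ltnS half_leq.
rewrite big_mkcond; apply: eq_bigr => k _; rewrite ltnS geq_half_double.
have [kl|lk] := leqP k.*2 l; first by rewrite subSn//= -iterSr.
by move: lk; rewrite -subn_eq0 => /eqP -> /=; rewrite scale0r.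
Qed.

Lemma homog_shiftL c l w : homog c l (L w) = homog (shiftL c) l.+2 w.
Proof.
rewrite /homog [RHS]big_ord_recl /= scale0r add0r; apply: eq_bigr => k _.
have NL j : iter j N (L w) = L (iter j N w) by elim: j => //= j ->; rewrite LN.
by rewrite /bump leq0n add1n doubleS !subSS NL -iterSr.
Qed.

(** Negative degrees give 0, so that the relations below hold for every a with
    the degrees a - 1 and a - 2 written as integers. *)
Definition juhl_op mu (z : int) w : W :=
  match z with Posz l => homog (juhl mu) l w | Negz _ => 0 end.

Lemma juhl_op_is_linear mu z : linear (juhl_op mu z).
Proof.
by case: z => l x u v /=; rewrite ?linearP// scaler0 addr0.
Qed.

HB.instance Definition _ mu z :=
  GRing.isLinear.Build R[i] W W *:%R (juhl_op mu z) (juhl_op_is_linear mu z).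

Lemma subz1S a : a.+1%:Z - 1 = a. Proof. by rewrite -addn1 PoszD addrK. Qed.

Lemma subz2S a : a.+1%:Z - 2 = a%:Z - 1. Proof. by rewrite -addn1 PoszD; ring. Qed.

Lemma juhl_op_N1 mu a w :
  juhl_op mu (a%:Z - 1) (N w) = homog (shiftN (juhl mu)) a w.
Proof.
case: a => [|a]; last by rewrite subz1S -homog_shiftN.
by rewrite /homog big_ord1 scale0r.
Qed.

Lemma juhl_op_N2 mu a w :
  juhl_op mu (a%:Z - 2) (N (N w)) = homog (shiftN (shiftN (juhl mu))) a w.
Proof.
case: a => [|[|a]]; first by rewrite /homog big_ord1 scale0r.
  by rewrite /homog big_ord1 scale0r.
by rewrite subz2S subz1S -!homog_shiftN.
Qed.

Lemma juhl_op_L2 mu a w :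
  juhl_op mu (a%:Z - 2) (L w) = homog (shiftL (juhl mu)) a w.
Proof.
case: a => [|[|a]]; first by rewrite /homog big_ord1 scale0r.
  by rewrite /homog big_ord1 scale0r.
by rewrite subz2S subz1S -homog_shiftL.
Qed.

Definition full_lap w := L w + N (N w).

Lemma juhl_op_contiguity mu a w :
  gamma_coef mu a *: juhl_op (mu + 1) (a%:Z - 1) w
  - gamma_coef (mu - 1 / 2%:R) a *: juhl_op mu (a%:Z - 1) w
  = juhl_op (mu + 1) (a%:Z - 2) (N w).
Proof.
case: a => [|a]; first by rewrite /= !scaler0 subr0.
rewrite subz2S subz1S juhl_op_N1 -scaleNr -!homogZ -homogD.
by apply: eq_homog => k j <-; rewrite mulNr juhl_contiguity_N.
Qed.

Lemma juhl_op_lap mu a w :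
  juhl_op (mu + 1) (a%:Z - 2) (full_lap w)
  + gamma_coef (mu - 1 / 2%:R) a *: juhl_op mu (a%:Z - 1) (N w)
  = (a%:R / 2%:R) *: juhl_op mu a w.
Proof.
rewrite /full_lap linearD /= juhl_op_L2 juhl_op_N1 juhl_op_N2 -!homogZ -!homogD.
by apply: eq_homog => k j <-; rewrite juhl_contiguity_L.
Qed.

(** Since a and a + 1 have opposite parity, one of the two factors is 1. *)
Lemma gamma_coefM mu a :
  gamma_coef (mu - 1 / 2%:R) a * gamma_coef (mu - 1) a.+1
  = mu - 1 / 2%:R + a%:R / 2%:R.
Proof.
rewrite /gamma_coef oddS -natr1.
by case: (odd a); rewrite ?mul1r ?mulr1; field.
Qed.

(** Obtained by eliminating D^mu_{a-1} N between the two contiguity relations, the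
    first one taken at mu - 1 and a + 1. *)
Lemma juhl_op_lap_same mu a w :
  juhl_op (mu + 1) (a%:Z - 2) (full_lap w) + (mu - 1 / 2%:R) *: juhl_op mu a w
  = (gamma_coef (mu - 1 / 2%:R) a * gamma_coef (mu - 1 - 1 / 2%:R) a.+1)
    *: juhl_op (mu - 1) a w.
Proof.
have := juhl_op_contiguity (mu - 1) a.+1 w; rewrite subz2S subz1S subrK => E1.
have E4 := juhl_op_lap mu a w.
rewrite -E1 scalerBr !scalerA gamma_coefM [in LHS]scalerDl in E4.
move/(canRL (addrK _)): E4 => ->; rewrite opprB addrCA.
by rewrite opprD [_ *: _ + (- _ + _)]addrCA subrr addr0 subrK.
Qed.

(** Expanding the right-hand side by [juhl_op_lap] at mu - 1 and a + 1 and using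
    [juhl_op_lap_same] on N w, what remains is the first contiguity relation
    applied to (L + N^2) w. *)
Lemma juhl_op_lap_next mu a w :
  gamma_coef mu a *: juhl_op (mu + 1) (a%:Z - 1) (full_lap w)
  + (mu - 1 / 2%:R) *: juhl_op mu a (N w)
  = (gamma_coef (mu - 1 / 2%:R) a * (a.+1%:R / 2%:R))
    *: juhl_op (mu - 1) a.+1 w.
Proof.
have := juhl_op_lap (mu - 1) a.+1 w; rewrite subz2S subz1S subrK => E4.
rewrite -scalerA -E4 scalerDr scalerA -juhl_op_lap_same.
rewrite addrA; congr (_ + _).
have /eqP := juhl_op_contiguity mu a (full_lap w).
rewrite subr_eq => /eqP ->; rewrite addrC.
by rewrite /full_lap !linearD /= LN.
Qed.
End HomogeneousOperators.
Arguments juhl_op : simpl never.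

(** * Exterior calculus from anticommutation relations *)

(** The constant-coefficient calculus is modelled by commuting operators p_j (the
    partial derivatives) and operators a true j (exterior multiplication by dx_j)
    and a false j (interior multiplication by the j-th coordinate field) that
    commute with them and satisfy the canonical anticommutation relations. *)
Section ExteriorCalculus.
Variables (R : realType) (m : nat) (W : lmodType R[i]).
Variables (p : 'I_m.+1 -> {linear W -> W}) (a : bool -> 'I_m.+1 -> {linear W -> W}).
Hypothesis pC : forall j k w, p j (p k w) = p k (p j w).
Hypothesis pa : forall j b k w, p j (a b k w) = a b k (p j w).
Hypothesis clifford : forall b j c k w,
  a b j (a c k w) + a c k (a b j w) = if (j == k) && (b != c) then w else 0.
Implicit Types (w : W) (b c : bool).

(** b = true gives d, and b = false gives minus its adjoint; their sum is the Dirac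
    operator whose square is the Laplacian. *)
Definition half_dirac b w := \sum_j p j (a b j w).

Lemma half_dirac_is_linear b : linear (half_dirac b).
Proof.
move=> x u v; rewrite scaler_sumr -big_split; apply: eq_bigr => j _ /=.
by rewrite !linearP.
Qed.
HB.instance Definition _ b :=
  GRing.isLinear.Build R[i] W W *:%R (half_dirac b) (half_dirac_is_linear b).

Lemma p_half_dirac j b w : p j (half_dirac b w) = half_dirac b (p j w).
Proof. by rewrite linear_sum; apply: eq_bigr => k _; rewrite pC !pa. Qed.

(** For b = true and c = false this is Cartan's formula for the Lie derivative
    along a coordinate field. *)
Lemma half_dirac_ladder b c k w :
  half_dirac b (a c k w) + a c k (half_dirac b w) = if b != c then p k w else 0.
Proof.
rewrite linear_sum -big_split /=.
under eq_bigr => j _ do rewrite -pa -linearD clifford.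
case: ifP => bc; last by rewrite big1// => j _; rewrite andbF linear0.
rewrite (bigD1 k)//= eqxx big1 ?addr0// => j /negPf ->.
by rewrite linear0.
Qed.

Lemma half_dirac_anticomm b c w :
  half_dirac b (half_dirac c w) + half_dirac c (half_dirac b w)
  = if b != c then \sum_j p j (p j w) else 0.
Proof.
rewrite {1}/half_dirac [X in _ + X]linear_sum -big_split /=.
under eq_bigr => j _ do
  rewrite -p_half_dirac -linearD [a b j _ + _]addrC half_dirac_ladder eq_sym.
by case: ifP => _ //; rewrite big1// => j _; rewrite linear0.
Qed.

(** The anticommutator of the operator with itself is twice its square. *)
Lemma half_dirac_sqr b w : half_dirac b (half_dirac b w) = 0.
Proof.
have := half_dirac_anticomm b b w; rewrite eqxx /= -mulr2n -scaler_nat => /eqP.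
by rewrite scaler_eq0 pnatr_eq0 => /eqP.
Qed.

Local Notation d := (half_dirac true).
Definition codiff_op w := - half_dirac false w.
Local Notation iota := (a false ord_max).
Local Notation N := (p ord_max).

Definition lap_tan w := \sum_(k < m) p (lift ord_max k) (p (lift ord_max k) w).

Lemma lap_tan_is_linear : linear lap_tan.
Proof.
move=> x u v; rewrite scaler_sumr -big_split; apply: eq_bigr => j _ /=.
by rewrite !linearP.
Qed.
HB.instance Definition _ :=
  GRing.isLinear.Build R[i] W W *:%R lap_tan lap_tan_is_linear.

Lemma lap_tan_N w : lap_tan (N w) = N (lap_tan w).
Proof.
by rewrite linear_sum; apply: eq_bigr => k _; rewrite ![p _ (N _)]pC.
Qed.

Local Notation D := (juhl_op lap_tan N).
Local Notation Lap := (full_lap lap_tan N).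

Lemma full_lapE w : Lap w = \sum_j p j (p j w).
Proof. by rewrite (bigD1_ord ord_max)//= addrC. Qed.

Lemma codiff_op_is_linear : linear codiff_op.
Proof. by move=> x u v; rewrite /codiff_op linearP opprD scalerN. Qed.
HB.instance Definition _ :=
  GRing.isLinear.Build R[i] W W *:%R codiff_op codiff_op_is_linear.

Lemma codiff_opK w : codiff_op (codiff_op w) = 0.
Proof. by rewrite /codiff_op linearN /= half_dirac_sqr !oppr0. Qed.

Lemma hodge w : d (codiff_op w) = - Lap w - codiff_op (d w).
Proof.
rewrite full_lapE /codiff_op linearN.
by have /= <- := half_dirac_anticomm true false w; rewrite opprD opprK subrK.
Qed.

Lemma cartan w : iota (d w) = N w - d (iota w).
Proof. by have /= <- := half_dirac_ladder true false ord_max w; rewrite addrC addKr. Qed.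

Lemma iota_codiff_op w : iota (codiff_op w) = - codiff_op (iota w).
Proof.
rewrite /codiff_op linearN /=; congr (- _); apply/eqP.
by rewrite -addr_eq0 addrC half_dirac_ladder eqxx.
Qed.

Definition down_op i u e w :=
  let mu := mu_param m u i in
  -1 *: D (mu + 1) (e%:Z - 2) (d (codiff_op (iota w)))
  + (- gamma_coef mu e) *: D (mu + 1) (e%:Z - 1) (codiff_op w)
  + ((u + (2 * i)%:R - m.+1%:R) / 2%:R) *: D mu e (iota w).

Definition same_op i u e w :=
  let mu := mu_param m u i in
  D (mu + 1) (e%:Z - 2) (d (codiff_op w))
  + (- gamma_coef (mu - 1 / 2%:R) e) *: D mu (e%:Z - 1) (d (iota w))
  + ((u + e%:R) / 2%:R) *: D mu e w.

(** Since d d^* d = - (L + N^2) d and d iota d = N d, the second contiguity relation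
    makes the three terms cancel. *)
Lemma same_op_d i e w : same_op i.+1 0 e (d w) = 0.
Proof.
rewrite /same_op; set mu := mu_param _ _ _.
rewrite hodge half_dirac_sqr /codiff_op !linear0 addr0.
rewrite cartan linearB /= half_dirac_sqr subr0 add0r.
rewrite -juhl_op_lap; last exact: lap_tan_N.
rewrite -p_half_dirac linearN scaleNr /=.
by rewrite -opprD addNr.
Qed.

(** The first two terms die because d^* squares to 0 and anticommutes with iota,
    the last because its scalar coefficient is 0 for this value of u. *)
Lemma down_op_codiff i e w : (1 < i)%N ->
  down_op i.-1 (m.+1%:R - 2%:R * i%:R + 2%:R) e (codiff_op w) = 0.
Proof.
move=> i1; rewrite /down_op codiff_opK.
have -> : codiff_op (iota (codiff_op w)) = 0.
  by rewrite iota_codiff_op (linearN codiff_op) /= codiff_opK oppr0.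
rewrite !linear0 ?scaler0 ?add0r.
have -> : (2 * i.-1)%:R = 2%:R * i%:R - 2%:R :> R[i].
  by case: i i1 => // i _; rewrite natrM -natr1 /=; ring.
have -> : m.+1%:R - 2%:R * i%:R + 2%:R + (2%:R * i%:R - 2%:R) - m.+1%:R = 0 :> R[i].
  by ring.
by rewrite mul0r scale0r.
Qed.

(** Since d^* d^* = 0 and iota anticommutes with d^*, each side is a combination of
    D^mu_{a-1} d d^* iota and D^mu_a d^*; the coefficients agree by
    [gamma_coefM]. *)
Lemma same_op_codiff i e w : (0 < i)%N ->
  same_op i.-1 (m.+1%:R - 2%:R * i%:R + 2%:R) e (codiff_op w)
  = (- gamma_coef (- i%:R + 1 + m.+1%:R / 2%:R) e)
    *: down_op i (m.+1%:R - 2%:R * i%:R) e.+1 w.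
Proof.
case: i => // i _; rewrite /same_op /down_op /=.
set mu := mu_param _ _ i.
have -> : mu_param m (m.+1%:R - 2%:R * i.+1%:R) i.+1 = mu - 1.
  by rewrite /mu /mu_param -!natr1; field.
have -> : - i.+1%:R + 1 + m.+1%:R / 2%:R = mu - 1 / 2%:R.
  by rewrite /mu /mu_param -!natr1; field.
have -> : (m.+1%:R - 2%:R * i.+1%:R + (2 * i.+1)%:R - m.+1%:R) / 2%:R = 0 :> R[i].
  by rewrite natrM; ring.
rewrite codiff_opK !linear0 add0r scale0r addr0 subrK subz2S subz1S.
rewrite iota_codiff_op (linearN (half_dirac true)) (linearN (juhl_op _ _ _ _)) /=.
rewrite scaleN1r scalerDr scalerA mulrNN gamma_coefM.
by congr (_ + _ *: _); rewrite /mu /mu_param -!natr1; field.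
Qed.

Lemma codiff_op_d w : codiff_op (d w) = - (Lap w + d (codiff_op w)).
Proof. by rewrite hodge addNKr opprK. Qed.

Lemma lap_half_dirac b w : Lap (half_dirac b w) = half_dirac b (Lap w).
Proof.
by rewrite !full_lapE linear_sum; apply: eq_bigr => j _; rewrite !p_half_dirac.
Qed.

Lemma lap_ladder b k w : Lap (a b k w) = a b k (Lap w).
Proof. by rewrite !full_lapE linear_sum; apply: eq_bigr => j _; rewrite !pa. Qed.

Lemma d_codiff_iota_d w :
  d (codiff_op (iota (d w))) = Lap (d (iota w)) + N (d (codiff_op w)).
Proof.
have -> : codiff_op (iota (d w)) = iota (Lap w) + iota (d (codiff_op w)).
  by rewrite -[codiff_op _]opprK -iota_codiff_op codiff_op_d linearN opprK linearD.
rewrite cartan (linearD (half_dirac true)) (linearB (half_dirac true)) /=.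
by rewrite half_dirac_sqr subr0 -lap_ladder -lap_half_dirac p_half_dirac.
Qed.

(** Everything is written in terms of d d^* w, d (iota w) and w; their scalar
    coefficients match by [juhl_op_contiguity], [juhl_op_lap_same] and
    [juhl_op_lap_next] respectively. *)
Lemma down_op_d i e w :
  down_op i.+1 0 e (d w)
  = gamma_coef (i%:R + 1 - m.+1%:R / 2%:R) e *: same_op i 0 e.+1 w.
Proof.
rewrite /same_op /down_op /=.
set mu := mu_param _ _ i.+1.
have -> : mu_param m 0 i = mu - 1 by rewrite /mu /mu_param -!natr1; ring.
have -> : i%:R + 1 - m.+1%:R / 2%:R = mu - 1 / 2%:R.
  by rewrite /mu /mu_param -!natr1; field.
have -> : (0 + (2 * i.+1)%:R - m.+1%:R) / 2%:R = mu - 1 / 2%:R.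
  by rewrite /mu /mu_param natrM -!natr1; field.
rewrite add0r subrK subz2S subz1S.
rewrite d_codiff_iota_d cartan codiff_op_d.
have E1 := juhl_op_contiguity lap_tan N mu e (d (codiff_op w)).
have E2 := juhl_op_lap_same lap_tan_N mu e (d (iota w)).
have E3 := juhl_op_lap_next lap_tan_N mu e w.
rewrite !scalerDr !scalerA scaleN1r mulrN -E3 !scaleNr -E2.
rewrite (linearD (juhl_op lap_tan N (mu + 1) (e%:Z - 2))) /=.
rewrite (linearN (juhl_op lap_tan N (mu + 1) (e%:Z - 1))) /=.
rewrite (linearD (juhl_op lap_tan N (mu + 1) (e%:Z - 1))) /=.
rewrite (linearB (juhl_op lap_tan N mu e)) /= scalerBr scalerN opprK.
rewrite [X in _ + X + _]scalerDr; move/(canRL (subrK _)): E1 => ->.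
rewrite ![- (juhl_op _ _ _ _ _ + _)]opprD !addrA.
(* The second and fourth summands, which cancel, are brought to the front. *)
by rewrite [LHS](+%R.[ACl 2*4*5*1*7*3*6]) addNr add0r.
Qed.
End ExteriorCalculus.

(** * Smooth forms as an instance *)

Section Toggle.
Variable n : nat.
Implicit Types (j k l : 'I_n) (I J : {set 'I_n}).

(** Exterior and interior multiplication read off the coefficient at the same
    modified index set, which lets one formula treat both. *)
Definition toggle j I := if j \in I then I :\ j else j |: I.

Lemma in_toggle j k I : (k \in toggle j I) = (k == j) (+) (k \in I).
Proof.
by rewrite /toggle; case: ifP => jI; rewrite !inE; case: eqVneq => //= ->;
  rewrite jI.
Qed.

Lemma toggleC j k I : toggle j (toggle k I) = toggle k (toggle j I).
Proof. by apply/setP => l; rewrite !in_toggle addbCA. Qed.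

Lemma toggleK j : involutive (toggle j).
Proof. by move=> I; apply/setP => l; rewrite !in_toggle addKb. Qed.

Variable R : realType.

(** As a product over single indices the sign is visibly multiplicative under
    changes of I. *)
Lemma ext_signE j I :
  ext_sign R j I = \prod_(l : 'I_n | (l < j)%N) (-1) ^+ (l \in I).
Proof.
rewrite /ext_sign -prodr_const big_mkcond [RHS]big_mkcond; apply: eq_bigr => l _.
by rewrite inE; case: (l \in I); case: ltnP.
Qed.

(** This factor is the source of the anticommutation of distinct dx_j and dx_k. *)
Lemma ext_sign_toggle j k I :
  ext_sign R j (toggle k I) = (-1) ^+ (k < j)%N * ext_sign R j I.
Proof.
rewrite !ext_signE; under eq_bigr do rewrite in_toggle signr_addb.
rewrite big_split /=; congr (_ * _).
have [kj|jk] := ltnP k j.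
  rewrite (bigD1 k) //= eqxx big1 ?mulr1// => l /andP[_ /negPf ->].
  by rewrite expr0.
rewrite big1// => l lj; case: eqVneq => // lk.
by move: lj; rewrite lk ltnNge jk.
Qed.

Lemma ext_sign_sqr j I : ext_sign R j I * ext_sign R j I = 1.
Proof. by rewrite /ext_sign -expr2 sqrr_sign. Qed.

Lemma wedge_dxE j I J : wedge_dx R j I J =
  if (j \in I) && (J == toggle j I) then ext_sign R j I else 0.
Proof.
rewrite /wedge_dx.
have [->|JI] := eqVneq J (toggle j I).
  rewrite in_toggle eqxx andbT addTb negbK ext_sign_toggle ltnn mul1r.
  by rewrite /toggle; case: (boolP (j \in I)) => //= jI; rewrite finset.setD1K ?eqxx.
rewrite andbF; case: ifP => // /andP[jJ /eqP E]; move: JI.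
by rewrite E /toggle finset.setU11 finset.setU1K// eqxx.
Qed.

Lemma adj_wedge_dxE j I J : adj_coef (@wedge_dx R n) j I J =
  if (j \notin I) && (J == toggle j I) then - ext_sign R j I else 0.
Proof.
rewrite /adj_coef wedge_dxE.
have -> : (I == toggle j J) = (J == toggle j I).
  by rewrite -(inj_eq (inv_inj (toggleK j))) toggleK eq_sym.
have [->|_] := eqVneq J (toggle j I); last by rewrite !andbF rmorph0 oppr0.
rewrite in_toggle eqxx !andbT addTb; case: ifP => _; last by rewrite rmorph0 oppr0.
by rewrite ext_sign_toggle ltnn mul1r /ext_sign rmorph_sign.
Qed.
End Toggle.

Section SmoothForms.
Variables (R : realType) (n : nat).

(** The regular module structure on the values makes forms a complex vector
    space pointwise. *)
Definition cform : lmodType R[i] := {set 'I_n} -> 'rV[R]_n -> R[i]^o.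

Definition smooth_form : {pred cform} :=
  fun w => `[< forall I, smooth (w I) >].

Lemma smooth_form_submod : submod_closed smooth_form.
Proof.
split; first by apply/asboolP => I; exact: smooth0.
move=> c v w /asboolP sv /asboolP sw; apply/asboolP => I.
exact: smooth_lin.
Qed.

HB.instance Definition _ :=
  GRing.isSubmodClosed.Build R[i] cform smooth_form smooth_form_submod.

Definition sform := {w : cform | smooth_form w}.
HB.instance Definition _ := Choice.on sform.
HB.instance Definition _ := SubType.on sform.
HB.instance Definition _ := [SubChoice_isSubLmodule of sform by <:].

Lemma sform_smooth (w : sform) I : smooth (val w I).
Proof. by have /asboolP := valP w. Qed.

Definition mk_sform (w : cform) (sw : forall I, smooth (w I)) : sform :=
  exist _ w (introT (asboolP _) sw).

Definition partial_form j (w : sform) : sform :=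
  mk_sform (fun I => smooth_partial j (sform_smooth w I)).

Lemma partial_form_is_linear j : linear (partial_form j).
Proof.
move=> c v w; apply/val_inj/funext => I /=.
exact: (partial_lin _ _ (sform_smooth v I) (sform_smooth w I)).
Qed.
HB.instance Definition _ j :=
  GRing.isLinear.Build R[i] sform sform *:%R
    (partial_form j) (partial_form_is_linear j).

Lemma partial_formC j k w :
  partial_form j (partial_form k w) = partial_form k (partial_form j w).
Proof.
by apply/val_inj/funext => I; apply: (partial_comm _ _ (sform_smooth w I)).
Qed.

(** Exterior multiplication by dx_j for b = true, interior multiplication for
    b = false. *)
Definition ladder_fun (b : bool) j (w : cform) : cform :=
  fun I x => if (j \in I) == b then ext_sign R j I * w (toggle j I) x else 0.

Lemma ladder_smooth b j (w : sform) I : smooth (ladder_fun b j (val w) I).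
Proof.
rewrite /ladder_fun; case: (_ == b); last exact: smooth0.
have := smooth_lin (ext_sign R j I) (sform_smooth w (toggle j I)) (@smooth0 R n).
by under eq_fun do rewrite addr0.
Qed.

Definition ladder b j (w : sform) : sform := mk_sform (ladder_smooth b j w).

Lemma ladder_is_linear b j : linear (ladder b j).
Proof.
move=> c v w; apply/val_inj/funext => I; apply/funext => x /=.
rewrite /ladder_fun !fctE /=; case: ifP => _; last by rewrite scaler0 addr0.
by rewrite mulrDr; congr (_ + _); exact: mulrCA.
Qed.
HB.instance Definition _ b j :=
  GRing.isLinear.Build R[i] sform sform *:%R (ladder b j) (ladder_is_linear b j).

Lemma partial_form_ladder j b k w :
  partial_form j (ladder b k w) = ladder b k (partial_form j w).
Proof.
apply/val_inj/funext => I; apply/funext => x; rewrite /= /ladder_fun.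
case: ifP => _.
  by rewrite (pderZ _ (smooth_pderivable j x (sform_smooth w _))).2.
by rewrite /partial -[repart _]/(cst 0) -[impart _]/(cst 0) !derive_cst.
Qed.

(** For j = k the signs square to 1 and, if b differs from c, exactly one of the
    two summands is present at each I. For distinct j and k the two orders differ
    by a sign, as exactly one of j < k and k < j holds. *)
Lemma ladder_clifford b j c k w :
  ladder b j (ladder c k w) + ladder c k (ladder b j w)
  = if (j == k) && (b != c) then w else 0.
Proof.
apply/val_inj/funext => I; apply/funext => x.
transitivity (ladder_fun b j (ladder_fun c k (val w)) I x
  + ladder_fun c k (ladder_fun b j (val w)) I x) => //.
rewrite /ladder_fun !in_toggle !ext_sign_toggle.
have [->|jk] := eqVneq j k; rewrite /=.
  rewrite !toggleK ltnn !mul1r.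
  by case: b; case: c; case: (k \in I);
    rewrite /= ?mulr0 ?addr0 ?add0r ?mulrA ?ext_sign_sqr ?mul1r.
rewrite toggleC /= -[RHS]/(0 : R[i]).
case: eqP => _; case: eqP => _; rewrite ?mulr0 ?addr0//.
have opp : (-1) ^+ (j < k)%N + (-1) ^+ (k < j)%N = 0 :> R[i].
  case: ltngtP jk => [||/val_inj ->]; rewrite ?eqxx// => _ _.
    by rewrite addrC subrr.
  by rewrite subrr.
set y := sval w _ x.
transitivity (((-1) ^+ (j < k)%N + (-1) ^+ (k < j)%N)
  * (ext_sign R j I * (ext_sign R k I * y))); last by rewrite opp mul0r.
by rewrite mulrDl; congr (_ + _); ring.
Qed.
End SmoothForms.

(** * The operators on differential forms *)

Section Bridge.
Variables (R : realType) (m : nat).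
Implicit Types (w : sform R m.+1) (I : {set 'I_m.+1}) (x : 'rV[R]_m.+1).

(** The families are bundled as linear maps so that the abstract calculus applies
    to them. *)
Definition partial_form_lin j : {linear sform R m.+1 -> sform R m.+1} :=
  @partial_form R m.+1 j.
Definition ladder_lin b j : {linear sform R m.+1 -> sform R m.+1} :=
  @ladder R m.+1 b j.
Local Notation P := partial_form_lin.
Local Notation A := ladder_lin.

Lemma val_sum (T : Type) (r : seq T) (F : T -> sform R m.+1) I x :
  val (\sum_(t <- r) F t) I x = \sum_(t <- r) val (F t) I x.
Proof. by elim/big_rec2: _ => // t y1 y2 _ <-. Qed.

Lemma val_opp w I x : val (- w) I x = - val w I x.
Proof. by []. Qed.

Lemma val_scale (c : R[i]) w I x : val (c *: w) I x = c * val w I x.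
Proof. by rewrite linearZ_LR /= !scalrfctE. Qed.

Lemma val_half_dirac b w I x : val (half_dirac P A b w) I x =
  \sum_j if (j \in I) == b
          then ext_sign R j I * partial j (val w (toggle j I)) x else 0.
Proof.
by rewrite val_sum; apply: eq_bigr => j _; rewrite [P j _]partial_form_ladder.
Qed.

Lemma sum_delta (J0 : {set 'I_m.+1}) (c : R[i]) (F : {set 'I_m.+1} -> R[i]) :
  \sum_J (if J == J0 then c else 0) * F J = c * F J0.
Proof.
rewrite (bigD1 J0)//= eqxx big1 ?addr0// => J /negPf ->; exact: mul0r.
Qed.

Lemma ext_dE w : ext_d (val w) = val (half_dirac P A true w).
Proof.
apply/funext => I; apply/funext => x; rewrite val_half_dirac; apply: eq_bigr => j _.
under eq_bigr do rewrite wedge_dxE.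
by case: (j \in I); rewrite /= ?sum_delta// big1// => J _; rewrite mul0r.
Qed.

(** The adjoint of exterior multiplication by dx_j in the basis dx_I is interior
    multiplication, whence the sign relative to the b = false operator. *)
Lemma codiffE w : codiff (val w) = val (codiff_op P A w).
Proof.
apply/funext => I; apply/funext => x.
rewrite /codiff_op val_opp val_half_dirac -sumrN.
apply: eq_bigr => j _.
under eq_bigr do rewrite adj_wedge_dxE.
by case: (j \in I);
  rewrite /= ?sum_delta ?mulNr ?oppr0// big1// => J _; rewrite mul0r.
Qed.

Lemma interior_mulE w j : interior_mul j (val w) = val (A false j w).
Proof.
apply/funext => I; apply/funext => x; rewrite /= /ladder_fun /interior_mul.
by rewrite /toggle; case: (j \in I).
Qed.

Lemma laplacian_hypE w I : laplacian_hyp (val w I) = val (lap_tan P w) I.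
Proof. by apply/funext => x; rewrite val_sum. Qed.

Lemma form_DE mu z w :
  form_D mu z (val w) = val (juhl_op (lap_tan P) (P ord_max) mu z w).
Proof.
apply/funext => I; apply/funext => x.
rewrite /form_D /juhl_op; case: z => //= l.
rewrite val_sum; apply: eq_bigr => k _.
have N_iter j :
    iter j (partial ord_max) (val w I) = val (iter j (P ord_max) w) I.
  by elim: j => //= j ->.
have L_iter j v :
    iter j (@laplacian_hyp R m) (val v I) = val (iter j (lap_tan P) v) I.
  by elim: j => //= j ->; rewrite laplacian_hypE.
rewrite N_iter L_iter /juhl.
have kl : (k.*2 <= l)%N by rewrite -geq_half_double -ltnS.
have lk : (l - k.*2 + k = l - k)%N by lia.
by rewrite val_scale (subnK kl) lk.
Qed.

Lemma form_addE v w : form_add (val v) (val w) = val (v + w).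
Proof. by []. Qed.

Lemma form_scaleE (c : R[i]) w : form_scale c (val w) = val (c *: w).
Proof. by apply/funext => I; apply/funext => x; rewrite val_scale. Qed.

Lemma D_sameE i u e w :
  D_same i u e (val w) = rest_hyp (val (same_op P A i u e w)).
Proof.
rewrite /D_same codiffE interior_mulE !ext_dE !form_DE.
by rewrite !form_scaleE !form_addE.
Qed.

Lemma D_downE i u e w :
  D_down i u e (val w) = rest_hyp (val (down_op P A i u e w)).
Proof.
rewrite /D_down interior_mulE !codiffE !ext_dE !form_DE.
by rewrite !form_scaleE !form_addE.
Qed.

Lemma partial_form_lin_comm j k w : P j (P k w) = P k (P j w).
Proof. exact: partial_formC. Qed.

Lemma partial_ladder_lin_comm j b k w : P j (A b k w) = A b k (P j w).
Proof. exact: partial_form_ladder. Qed.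

Lemma ladder_lin_clifford b j c k w :
  A b j (A c k w) + A c k (A b j w) = if (j == k) && (b != c) then w else 0.
Proof. exact: ladder_clifford. Qed.

Lemma rest_hyp_scale (c : R[i]) w :
  rest_hyp (val (c *: w)) = form_scale c (rest_hyp (val w)).
Proof. by rewrite -form_scaleE. Qed.

Lemma rest_hyp0 : rest_hyp (val (0 : sform R m.+1)) = form_zero.
Proof. by []. Qed.
End Bridge.

(* The ambient space is R^n with n = m.+1. *)
Theorem theorem13p3 (R : realType) (m : nat) (hn : (2 <= m.+1)%N) (a : nat) :
  [/\ (* (1) *)
      forall (i : nat) (w : dform R m.+1), (i <= m)%N -> is_form i w ->
        D_down i.+1 0 a (ext_d w)
        = form_scale (gamma_coef (i%:R + 1 - m.+1%:R / 2%:R) a)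
            (D_same i 0 a.+1 w),
      (* (2) *)
      forall (i : nat) (w : dform R m.+1), (i.+2 <= m.+1)%N -> is_form i w ->
        D_same i.+1 0 a (ext_d w) = form_zero,
      (* (3) *)
      forall (i : nat) (w : dform R m.+1), (1 <= i <= m.+1)%N -> is_form i w ->
        D_same i.-1 (m.+1%:R - 2%:R * i%:R + 2%:R) a (codiff w)
        = form_scale (- gamma_coef (- i%:R + 1 + m.+1%:R / 2%:R) a)
            (D_down i (m.+1%:R - 2%:R * i%:R) a.+1 w)
    & (* (4) *)
      forall (i : nat) (w : dform R m.+1), (2 <= i <= m.+1)%N -> is_form i w ->
        D_down i.-1 (m.+1%:R - 2%:R * i%:R + 2%:R) a (codiff w) = form_zero].
Proof.
have lift i w : is_form i w -> exists v : sform R m.+1, w = val v.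
  by move=> fw; exists (mk_sform (fun I => (fw I).1)).
have pC := @partial_form_lin_comm R m; have pa := @partial_ladder_lin_comm R m.
have cl := @ladder_lin_clifford R m.
split=> i w hi /lift[v ->].
- by rewrite ext_dE D_downE D_sameE (down_op_d pC pa cl) rest_hyp_scale.
- by rewrite ext_dE D_sameE (same_op_d pC pa cl) rest_hyp0.
- case/andP: hi => hi _; rewrite codiffE D_sameE D_downE.
  by rewrite (same_op_codiff pC pa cl _ _ hi) rest_hyp_scale.
- case/andP: hi => hi _; rewrite codiffE D_downE.
  by rewrite (down_op_codiff pC pa cl _ _ hi) rest_hyp0.
Qed.
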